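(* Assume $\rho_{\min}>\gamma_{\max}$. If $$\epsilon:=4K_1\big(\rho_{\min}(\gamma_{\min}-1)\big)^{-1}<1,$$ then for every $p\in\mathbb{N}$ $$1+4(1-\epsilon)\sum_{k=0}^{p}\gamma_k^2\ \leq\ D(\Gamma^{0,p})_{22}\ \leq\ 1+4(1+\epsilon)\sum_{k=0}^{p}\gamma_k^2 .$$
   Context: Let $(r_n)_{n\ge 0}$ be integers with $r_0=1$, $\rho_{\min}=\inf_{n\ge1}r_n\ge 2$, $\rho_{\max}=\sup_{n\ge1}r_n<\infty$, and $R_n=\prod_{k=0}^n r_k$. Let $(\gamma_n)_{n\ge0}$ be reals with $\gamma_0=1$, $\gamma_{\min}=\inf_{n\ge0}\gamma_{n+1}/\gamma_n>1$, $\gamma_{\max}=\sup_{n\ge0}\gamma_{n+1}/\gamma_n<\infty$. Let $h_n:\mathbb{R}\to\mathbb{R}$ ($n\ge 0$) be smooth functions of period $1$ with $h_n(0)=0$, $\int_0^1\big(h_n(x)-\int_0^1h_n(y)dy\big)^2dx=1$, $K_0=\sup_n(\sup h_n-\inf h_n)<\infty$ and $K_1=\sup_n\|h_n'\|_\infty<\infty$. For $p\in\mathbb{N}=\{0,1,2,\dots\}$ let $H^{0,p}(x)=\sum_{n=0}^p\gamma_nh_n(x/R_n)$, which is $R_p$-periodic, and let $\Gamma^{0,p}$ be the $2\times2$ skew-symmetric matrix function with $\Gamma^{0,p}_{12}(x_1,x_2)=H^{0,p}(x_1)$. $D(\Gamma^{0,p})$ is the effective diffusivity associated to homogenization of the periodic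 operator $L=\tfrac12\Delta-\nabla\Gamma^{0,p}\nabla$ (that is, $Lu=\tfrac12\Delta u-\sum_{i,j}\partial_i(\Gamma^{0,p}_{ij}\partial_ju)$): it is the symmetric $2\times2$ matrix such that for all $l\in\mathbb{R}^2$, ${}^tl\,D(\Gamma^{0,p})\,l=R_p^{-2}\int_{[0,R_p]^2}|l-\nabla\chi_l(x)|^2dx$, where $\chi_l$ is the solution, $R_p$-periodic in each variable, of the cell problem $L(\chi_l-l\cdot x)=0$ with $\chi_l(0)=0$. *)

(* Defs.v *)
From Stdlib Require Import Reals ZArith ClassicalEpsilon.
From Coquelicot Require Import Coquelicot.
Open Scope R_scope.

(** ** Scales, amplitudes and fluctuations *)

Definition Rn (r : nat -> Z) (n : nat) : R := prod_f_R0 (fun k => IZR (r k)) n.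

(* Infima and suprema are taken in [Rbar], so that finiteness is a genuine
   hypothesis and not built into the definition. *)
Definition rho_min (r : nat -> Z) : Rbar :=
  Inf_seq (fun n => Finite (IZR (r (S n)))).
Definition rho_max (r : nat -> Z) : Rbar :=
  Sup_seq (fun n => Finite (IZR (r (S n)))).

Definition gamma_min (gamma : nat -> R) : Rbar :=
  Inf_seq (fun n => Finite (gamma (S n) / gamma n)).
Definition gamma_max (gamma : nat -> R) : Rbar :=
  Sup_seq (fun n => Finite (gamma (S n) / gamma n)).

Definition smooth (f : R -> R) : Prop := forall k x, ex_derive_n f k x.

Definition sup_fun (f : R -> R) : Rbar := Lub_Rbar (fun y => exists x, y = f x).
Definition inf_fun (f : R -> R) : Rbar := Glb_Rbar (fun y => exists x, y = f x).

Definition K0 (h : nat -> R -> R) : Rbar :=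
  Sup_seq (fun n => Rbar_minus (sup_fun (h n)) (inf_fun (h n))).
(* The derivatives are continuous, so their L^oo norm is a plain supremum. *)
Definition K1 (h : nat -> R -> R) : Rbar :=
  Sup_seq (fun n => sup_fun (fun x => Rabs (Derive (h n) x))).

(** ** Calculus on the plane

    Points and vectors of the plane are pairs.  Coordinates and matrix entries
    are numbered from 0: index 0 stands for the first coordinate, index 1 for
    the second. *)

Definition sum2 (F : nat -> R) : R := F 0%nat + F 1%nat.

Definition coord (v : R * R) (i : nat) : R :=
  match i with O => fst v | _ => snd v end.

Definition dot (v w : R * R) : R := sum2 (fun i => coord v i * coord w i).

Definition entry (A : matrix (T := R) 2 2) (i j : nat) : R := coeff_mat 0 A i j.

Definition section (i : nat) (f : R * R -> R) (x : R * R) : R -> R :=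
  match i with
  | O => fun t => f (t, snd x)
  | _ => fun t => f (fst x, t)
  end.

Definition ex_partial (i : nat) (f : R * R -> R) (x : R * R) : Prop :=
  ex_derive (section i f x) (coord x i).
Definition partial (i : nat) (f : R * R -> R) (x : R * R) : R :=
  Derive (section i f x) (coord x i).

Fixpoint is_Ck (k : nat) (f : R * R -> R) : Prop :=
  match k with
  | O => forall x : R * R, continuous f x
  | S k' =>
      (forall x : R * R, continuous f x) /\
      (forall i, (i < 2)%nat ->
         (forall x, ex_partial i f x) /\ is_Ck k' (partial i f))
  end.

Definition periodic2 (P : R) (f : R * R -> R) : Prop :=
  forall x1 x2, f (x1 + P, x2) = f (x1, x2) /\ f (x1, x2 + P) = f (x1, x2).

(** ** Homogenization of [1/2 Delta - div (Gamma grad)] *)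

Definition L (Gam : R * R -> matrix (T := R) 2 2) (u : R * R -> R)
    (x : R * R) : R :=
  1 / 2 * sum2 (fun i => partial i (partial i u) x)
  - sum2 (fun i => sum2 (fun j =>
      partial i (fun y => entry (Gam y) i j * partial j u y) x)).

(* Classical (C^2) solutions: all the matrix fields considered are smooth. *)
Definition is_cell_solution (Gam : R * R -> matrix (T := R) 2 2) (P : R)
    (l : R * R) (chi : R * R -> R) : Prop :=
  is_Ck 2 chi /\ periodic2 P chi /\ chi (0, 0) = 0 /\
  forall x, L Gam (fun y => chi y - dot l y) x = 0.

Definition cell_solution (Gam : R * R -> matrix (T := R) 2 2) (P : R)
    (l : R * R) : R * R -> R :=
  epsilon (inhabits (fun _ => 0)) (is_cell_solution Gam P l).

Definition cell_energy (Gam : R * R -> matrix (T := R) 2 2) (P : R)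
    (l : R * R) : R :=
  / P ^ 2 *
  RInt (fun x1 => RInt (fun x2 =>
    sum2 (fun i => (coord l i - partial i (cell_solution Gam P l) (x1, x2)) ^ 2))
    0 P) 0 P.

Definition is_effective_diffusivity (Gam : R * R -> matrix (T := R) 2 2) (P : R)
    (D : matrix (T := R) 2 2) : Prop :=
  entry D 0 1 = entry D 1 0 /\
  forall l : R * R,
    sum2 (fun i => sum2 (fun j => coord l i * entry D i j * coord l j))
    = cell_energy Gam P l.

Definition effective_diffusivity (Gam : R * R -> matrix (T := R) 2 2) (P : R) :
    matrix (T := R) 2 2 :=
  epsilon (inhabits (mk_matrix 2 2 (fun _ _ => 0)))
    (is_effective_diffusivity Gam P).

(** ** The multiscale shear flow *)

Definition H0 (r : nat -> Z) (gamma : nat -> R) (h : nat -> R -> R) (p : nat)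
    (x : R) : R :=
  sum_f_R0 (fun n => gamma n * h n (x / Rn r n)) p.

Definition Gamma0 (r : nat -> Z) (gamma : nat -> R) (h : nat -> R -> R)
    (p : nat) (x : R * R) : matrix (T := R) 2 2 :=
  mk_matrix 2 2 (fun i j =>
    match i, j with
    | 0%nat, 1%nat => H0 r gamma h p (fst x)
    | 1%nat, 0%nat => - H0 r gamma h p (fst x)
    | _, _ => 0
    end).

Definition D0 (r : nat -> Z) (gamma : nat -> R) (h : nat -> R -> R) (p : nat) :
    matrix (T := R) 2 2 :=
  effective_diffusivity (Gamma0 r gamma h p) (Rn r p).

Definition eps (r : nat -> Z) (gamma : nat -> R) (h : nat -> R -> R) : R :=
  4 * real (K1 h) * / (real (rho_min r) * (real (gamma_min gamma) - 1)).

(* Main.v *)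
Require Import Defs.
From Stdlib Require Import Reals ZArith Lra Lia FunctionalExtensionality
  ClassicalEpsilon.
From Coquelicot Require Import Coquelicot.
Open Scope R_scope.

(** For the shear [H(x1)] the cell problem has the explicit solution
    [-2 l2 int_0^x1 (H - mean H)], and an energy estimate shows that the gradient
    of a periodic solution is unique; hence [D_22 = 1 + 4 Var H].  The variance
    is estimated scale by scale.  Over a period [R_p] of the old scales, the new
    term [h_(p+1)(x / R_(p+1))] varies by at most [K1 / r_(p+1)], while the old
    centered sum has mean zero and mean absolute value at most
    [sum_(k <= p) gamma_k <= gamma_(p+1) / (gamma_min - 1)].  So adding the scale
    [p+1] changes the variance by [gamma_(p+1)^2] up to a relative error
    [2 K1 / (rho_min (gamma_min - 1)) = epsilon / 2]. *)

(** * Periodic and smooth functions of one variable *)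

(** A nondecreasing function with equal end values is constant between them, so its derivative
    vanishes there. This serves twice below: for a primitive of a nonnegative function and for a
    periodic function with nonnegative derivative. *)
Lemma nonneg_derive_eq_endpoints (G dG : R -> R) (a b x : R) :
  (forall t, is_derive G t (dG t)) -> (forall t, 0 <= dG t) ->
  G a = G b -> a < x < b -> dG x = 0.
Proof.
  intros HG Hpos Hab Hx.
  assert (incr : forall s t, s <= t -> G s <= G t).
  { intros s t Hst.
    destruct (MVT_gen G s t dG) as [c [_ Hc]].
    - intros y _. apply HG.
    - intros y _. apply continuity_pt_filterlim.
      apply (ex_derive_continuous G). exists (dG y). apply HG.
    - pose proof (Rmult_le_pos (dG c) (t - s) (Hpos c)). lra. }
  assert (cst : is_derive (fun _ : R => G a) x (dG x)).
  { apply (is_derive_ext_loc G); [|apply HG].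
    (* This radius keeps [t] between [a] and [b], where monotonicity squeezes [G t] between the
       equal values [G a] and [G b]. *)
    assert (Hd : 0 < Rmin (x - a) (b - x)) by (apply Rmin_pos; lra).
    exists (mkposreal _ Hd). intros t Ht.
    change (Rabs (t - x) < Rmin (x - a) (b - x)) in Ht.
    pose proof (Rmin_l (x - a) (b - x)). pose proof (Rmin_r (x - a) (b - x)).
    apply Rabs_def2 in Ht.
    assert (G a <= G t) by (apply incr; lra).
    assert (G t <= G b) by (apply incr; lra).
    lra. }
  apply is_derive_unique in cst. rewrite Derive_const in cst. lra.
Qed.

(** The difference quotients at the two points coincide, hence so do their limits; no
    differentiability is involved. *)
Lemma Derive_periodic (f : R -> R) (P x : R) :
  (forall t, f (t + P) = f t) -> Derive f (x + P) = Derive f x.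
Proof.
  intros Hf. unfold Derive. f_equal. apply Lim_ext. intros h.
  replace (x + P + h) with (x + h + P) by ring. now rewrite !Hf.
Qed.

Lemma continuous_mult_R {U : UniformSpace} (f g : U -> R) (x : U) :
  continuous f x -> continuous g x -> continuous (fun y => f y * g y) x.
Proof. apply (continuous_mult f g). Qed.

Lemma continuous_plus_R {U : UniformSpace} (f g : U -> R) (x : U) :
  continuous f x -> continuous g x -> continuous (fun y => f y + g y) x.
Proof. apply (continuous_plus f g). Qed.

Lemma continuous_minus_R {U : UniformSpace} (f g : U -> R) (x : U) :
  continuous f x -> continuous g x -> continuous (fun y => f y - g y) x.
Proof. apply (continuous_minus f g). Qed.

Lemma continuous_square {U : UniformSpace} (f : U -> R) (x : U) :
  continuous f x -> continuous (fun y => f y ^ 2) x.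
Proof.
  intros Hf. apply continuous_ext with (f := fun y => f y * f y).
  - intros; simpl; ring.
  - now apply continuous_mult_R.
Qed.

Lemma continuous_Rabs_comp {U : UniformSpace} (f : U -> R) (x : U) :
  continuous f x -> continuous (fun y => Rabs (f y)) x.
Proof. intros Hf. apply (continuous_comp f Rabs); [exact Hf | apply continuous_Rabs]. Qed.

(* The syntactic match keeps unification from unfolding real constants. *)
Ltac prove_continuous :=
  intros;
  lazymatch goal with
  | |- continuous (fun _ => ?c) _ => apply continuous_const
  | |- continuous (fun y => @?f y + @?g y) _ =>
      apply (continuous_plus_R f g); prove_continuous
  | |- continuous (fun y => @?f y - @?g y) _ =>
      apply (continuous_minus_R f g); prove_continuous
  | |- continuous (fun y => @?f y * @?g y) _ =>
      apply (continuous_mult_R f g); prove_continuous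
  | |- continuous (fun y => @?f y ^ 2) _ =>
      apply (continuous_square f); prove_continuous
  | |- continuous (fun y => Rabs (@?f y)) _ =>
      apply (continuous_Rabs_comp f); prove_continuous
  | _ => auto
  end.

(** * Integrals of continuous functions *)

Lemma ex_RInt_continuous_everywhere (f : R -> R) (a b : R) :
  (forall x, continuous f x) -> ex_RInt f a b.
Proof. intros Hf. apply (ex_RInt_continuous f). intros; apply Hf. Qed.

Lemma is_derive_RInt_continuous (f : R -> R) (a x : R) :
  (forall t, continuous f t) -> is_derive (fun t => RInt f a t) x (f x).
Proof.
  intros Hf. apply (is_derive_RInt f _ a); [|apply Hf].
  apply filter_forall. intros t. apply (RInt_correct f).
  now apply ex_RInt_continuous_everywhere.
Qed.

(** The primitive of [f] from [a] is nondecreasing and vanishes at both ends, so its derivative [f]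
    is zero in between. *)
Lemma RInt_nonneg_zero (f : R -> R) (a b x : R) :
  (forall t, continuous f t) -> (forall t, 0 <= f t) ->
  RInt f a b = 0 -> a < x < b -> f x = 0.
Proof.
  intros Hf Hpos H0 Hx.
  apply (nonneg_derive_eq_endpoints (fun t => RInt f a t) f a b); auto.
  - intros t. now apply is_derive_RInt_continuous.
  - rewrite H0. apply (RInt_point (V := R_CompleteNormedModule)).
Qed.

(* Coquelicot states equations between integrals in the carrier of a module,
   which [ring] and [field] do not recognize as [R]. *)
Ltac eq_in_R := match goal with |- @eq _ ?a ?b => change (@eq R a b) end.

Lemma RInt_plus_R (f g : R -> R) (a b : R) :
  (forall x, continuous f x) -> (forall x, continuous g x) ->
  RInt (fun x => f x + g x) a b = RInt f a b + RInt g a b.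
Proof.
  intros; apply (RInt_plus f g); now apply ex_RInt_continuous_everywhere.
Qed.

Lemma RInt_scal_R (f : R -> R) (k a b : R) :
  (forall x, continuous f x) ->
  RInt (fun x => k * f x) a b = k * RInt f a b.
Proof.
  intros; apply (RInt_scal f); now apply ex_RInt_continuous_everywhere.
Qed.

Lemma RInt_const_R (k a b : R) : RInt (fun _ => k) a b = (b - a) * k.
Proof. exact (RInt_const (V := R_CompleteNormedModule) a b k). Qed.

Lemma RInt_point_R (f : R -> R) (a : R) : RInt f a a = 0.
Proof. exact (RInt_point (V := R_CompleteNormedModule) a f). Qed.

Lemma RInt_Chasles_R (f : R -> R) (a b c : R) :
  (forall x, continuous f x) -> RInt f a c = RInt f a b + RInt f b c.
Proof.
  intros Hf. symmetry.
  apply (RInt_Chasles f); now apply ex_RInt_continuous_everywhere.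
Qed.

Lemma RInt_ext_R (f g : R -> R) (a b : R) :
  (forall x, f x = g x) -> RInt f a b = RInt g a b.
Proof. intros; apply (RInt_ext f g); auto. Qed.

Lemma RInt_shift (f : R -> R) (P a b : R) :
  (forall x, continuous f x) -> (forall x, f (x + P) = f x) ->
  RInt f (a + P) (b + P) = RInt f a b.
Proof.
  intros Hc Hf.
  pose proof (RInt_comp_lin f 1 P a b) as E.
  rewrite !Rmult_1_l in E. rewrite <- E.
  - apply RInt_ext_R. intros x. unfold scal; simpl; unfold mult; simpl.
    now rewrite !Rmult_1_l.
  - now apply ex_RInt_continuous_everywhere.
Qed.

(** * Closure properties of smooth functions *)

Lemma smooth_continuous (f : R -> R) (x : R) : smooth f -> continuous f x.
Proof. intros Hf. apply (ex_derive_continuous f). exact (Hf 1%nat x). Qed.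

Lemma smooth_is_derive (f : R -> R) (x : R) :
  smooth f -> is_derive f x (Derive f x).
Proof. intros Hf. apply Derive_correct. exact (Hf 1%nat x). Qed.

Lemma smooth_of_Derive (f : R -> R) :
  (forall x, ex_derive f x) -> smooth (Derive f) -> smooth f.
Proof.
  intros H1 H2 [|[|k]] x; [exact I | apply H1 |].
  specialize (H2 (S k) x). simpl in H2 |- *.
  eapply ex_derive_ext; [|exact H2]. intros t.
  change (Derive f) with (Derive_n f 1). rewrite Derive_n_comp.
  now replace (k + 1)%nat with (S k) by lia.
Qed.

Lemma smooth_Derive (f : R -> R) : smooth f -> smooth (Derive f).
Proof.
  intros Hf [|k] x; [exact I|]. specialize (Hf (S (S k)) x). simpl in Hf |- *.
  eapply ex_derive_ext; [|exact Hf]. intros t.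
  change (Derive f) with (Derive_n f 1). rewrite Derive_n_comp.
  now replace (k + 1)%nat with (S k) by lia.
Qed.

Lemma smooth_const (c : R) : smooth (fun _ => c).
Proof.
  intros k x. apply ex_derive_n_const.
Qed.

Lemma smooth_plus (f g : R -> R) :
  smooth f -> smooth g -> smooth (fun x => f x + g x).
Proof.
  intros Hf Hg k x.
  apply ex_derive_n_plus; apply filter_forall; intros; [apply Hf | apply Hg].
Qed.

Lemma smooth_scal (k : R) (f : R -> R) : smooth f -> smooth (fun x => k * f x).
Proof. intros Hf n x. apply ex_derive_n_scal_l, Hf. Qed.

Lemma smooth_comp_scal (k : R) (f : R -> R) :
  smooth f -> smooth (fun x => f (k * x)).
Proof.
  intros Hf n x. apply ex_derive_n_comp_scal, filter_forall. intros; apply Hf.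
Qed.

(** * Functions on the plane *)

Lemma is_Ck_continuous (k : nat) (f : R * R -> R) (x : R * R) :
  is_Ck k f -> continuous f x.
Proof. destruct k; simpl; [auto | intros [H _]; auto]. Qed.

Lemma is_Ck_ex_partial (k : nat) (f : R * R -> R) (i : nat) (x : R * R) :
  is_Ck (S k) f -> (i < 2)%nat -> ex_partial i f x.
Proof. intros [_ H] Hi. now apply H. Qed.

Lemma is_Ck_partial (k : nat) (f : R * R -> R) (i : nat) :
  is_Ck (S k) f -> (i < 2)%nat -> is_Ck k (partial i f).
Proof. intros [_ H] Hi. now apply H. Qed.

Lemma partial_const (i : nat) (c : R) :
  (i < 2)%nat -> partial i (fun _ => c) = fun _ => 0.
Proof.
  intros Hi. apply functional_extensionality. intros x.
  destruct i as [|[|i]]; [| |lia]; exact (Derive_const c _).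
Qed.

Lemma partial_1_fst (f : R -> R) : partial 1 (fun x => f (fst x)) = fun _ => 0.
Proof.
  apply functional_extensionality. intros x. exact (Derive_const (f (fst x)) _).
Qed.

Lemma is_Ck_const (k : nat) (c : R) : is_Ck k (fun _ => c).
Proof.
  revert c; induction k as [|k IH]; intros c; simpl.
  - intros. apply continuous_const.
  - split; [intros; apply continuous_const|].
    intros i Hi. split.
    + intros x. destruct i as [|[|i]]; try lia; apply ex_derive_const.
    + rewrite partial_const by exact Hi. apply IH.
Qed.

(** The induction is on [k] for all [f] at once: the first partial derivative is again of this form,
    with [Derive f] in place of [f], and the second one is zero. *)
Lemma is_Ck_fst (k : nat) (f : R -> R) :
  smooth f -> is_Ck k (fun x => f (fst x)).
Proof.
  revert f; induction k as [|k IH]; intros f Hf; simpl;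
    assert (Hc : forall x : R * R, continuous (fun x => f (fst x)) x)
      by (intros [x1 x2]; apply (continuous_comp fst f);
          [apply continuous_fst | now apply smooth_continuous]).
  - exact Hc.
  - split; [exact Hc|]. intros [|[|i]] Hi; [| |lia]; split.
    + intros x. exact (Hf 1%nat (fst x)).
    + exact (IH (Derive f) (smooth_Derive f Hf)).
    + intros x. exact (ex_derive_const (f (fst x)) (snd x)).
    + rewrite partial_1_fst. apply is_Ck_const.
Qed.

Lemma partial_minus (i : nat) (f g : R * R -> R) (x : R * R) :
  (i < 2)%nat -> ex_partial i f x -> ex_partial i g x ->
  partial i (fun y => f y - g y) x = partial i f x - partial i g x.
Proof.
  intros Hi Hf Hg. destruct i as [|[|i]]; [| |lia].
  - exact (Derive_minus (section 0 f x) (section 0 g x) _ Hf Hg).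
  - exact (Derive_minus (section 1 f x) (section 1 g x) _ Hf Hg).
Qed.

Lemma is_Ck_minus (k : nat) (f g : R * R -> R) :
  is_Ck k f -> is_Ck k g -> is_Ck k (fun x => f x - g x).
Proof.
  revert f g; induction k as [|k IH]; intros f g Hf Hg.
  - intros x. apply (continuous_minus f g); [apply Hf | apply Hg].
  - split.
    + intros x. apply (continuous_minus f g); eapply is_Ck_continuous; eassumption.
    + intros i Hi. split.
      * intros x.
        pose proof (is_Ck_ex_partial k f i x Hf Hi) as Hf'.
        pose proof (is_Ck_ex_partial k g i x Hg Hi) as Hg'.
        destruct i as [|[|i]]; [| |lia].
        -- exact (ex_derive_minus (section 0 f x) (section 0 g x) _ Hf' Hg').
        -- exact (ex_derive_minus (section 1 f x) (section 1 g x) _ Hf' Hg').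
      * replace (partial i _) with (fun x => partial i f x - partial i g x).
        -- apply IH; now apply is_Ck_partial.
        -- apply functional_extensionality. intros x. symmetry.
           apply partial_minus; [assumption | |];
             now apply (is_Ck_ex_partial k).
Qed.

Lemma partial_periodic (P : R) (f : R * R -> R) (i : nat) :
  periodic2 P f -> (i < 2)%nat -> periodic2 P (partial i f).
Proof.
  intros Hf Hi x y. unfold partial, section, coord.
  destruct i as [|[|i]]; [| |lia]; simpl; split.
  - apply (Derive_periodic (fun t => f (t, y))). intros; apply Hf.
  - apply Derive_ext. intros; apply Hf.
  - apply Derive_ext. intros; apply Hf.
  - apply (Derive_periodic (fun t => f (x, t))). intros; apply Hf.
Qed.

Lemma continuity_2d_continuous (f : R -> R -> R) (x y : R) :
  continuous (fun z : R * R => f (fst z) (snd z)) (x, y) ->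
  continuity_2d_pt f x y.
Proof. intros H. apply continuity_2d_pt_filterlim. exact H. Qed.

Lemma continuous_snd_slice (f : R * R -> R) (x y : R) :
  continuous f (x, y) -> continuous (fun t => f (x, t)) y.
Proof.
  intros H.
  apply (continuous_comp_2 (fun _ => x) (fun t => t) (fun a b => f (a, b))).
  - apply continuous_const.
  - apply continuous_id.
  - eapply continuous_ext; [|exact H]. now intros [a b].
Qed.

(** Needed for the shear operator, where skew-symmetry makes the two mixed second derivatives appear
    with opposite signs. *)
Lemma partial_comm (f : R * R -> R) (x : R * R) :
  is_Ck 2 f -> partial 0 (partial 1 f) x = partial 1 (partial 0 f) x.
Proof.
  intros Hf. destruct x as [x y].
  apply (Schwarz (fun a b => f (a, b)) x y).
  - apply locally_2d_forall. intros u v. repeat split.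
    + exact (is_Ck_ex_partial 1 f 0 (u, v) Hf ltac:(lia)).
    + exact (is_Ck_ex_partial 1 f 1 (u, v) Hf ltac:(lia)).
    + exact (is_Ck_ex_partial 0 _ 0 (u, v) (is_Ck_partial 1 f 1 Hf ltac:(lia)) ltac:(lia)).
    + exact (is_Ck_ex_partial 0 _ 1 (u, v) (is_Ck_partial 1 f 0 Hf ltac:(lia)) ltac:(lia)).
  - apply continuity_2d_continuous.
    apply continuous_ext with (f := partial 0 (partial 1 f)).
    + now intros [a b].
    + apply (is_Ck_partial 0 (partial 1 f) 0); [|lia].
      now apply is_Ck_partial; [|lia].
  - apply continuity_2d_continuous.
    apply continuous_ext with (f := partial 1 (partial 0 f)).
    + now intros [a b].
    + apply (is_Ck_partial 0 (partial 0 f) 1); [|lia].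
      now apply is_Ck_partial; [|lia].
Qed.

(** * The cell problem for a shear flow *)

(* The integral [E x1] of [w^2] over [x2] satisfies
   [E'' = 2 * int |grad w|^2 dx2 >= 0], while [E'] is periodic. *)
Lemma periodic_drift_gradient_zero (P : R) (w : R * R -> R) (b : R -> R) :
  0 < P -> is_Ck 2 w -> periodic2 P w ->
  (forall x, partial 0 (partial 0 w) x + partial 1 (partial 1 w) x
             = b (fst x) * partial 1 w x) ->
  forall x y, 0 < x < P -> 0 < y < P ->
  partial 0 w (x, y) = 0 /\ partial 1 w (x, y) = 0.
Proof.
  intros HP Hw Hper Heq.
  assert (Hw0 : is_Ck 1 (partial 0 w)) by (apply is_Ck_partial; [assumption|lia]).
  assert (Hw1 : is_Ck 1 (partial 1 w)) by (apply is_Ck_partial; [assumption|lia]).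
  assert (Hw00 : is_Ck 0 (partial 0 (partial 0 w))) by (apply is_Ck_partial; [assumption|lia]).
  assert (Hw11 : is_Ck 0 (partial 1 (partial 1 w))) by (apply is_Ck_partial; [assumption|lia]).
  pose proof (fun x => is_Ck_continuous _ _ x Hw) as Cw.
  pose proof (fun x => is_Ck_continuous _ _ x Hw0) as Cw0.
  pose proof (fun x => is_Ck_continuous _ _ x Hw1) as Cw1.
  pose proof (fun x => is_Ck_continuous _ _ x Hw00) as Cw00.
  pose proof (fun x => is_Ck_continuous _ _ x Hw11) as Cw11.
  assert (D0 : forall x y, is_derive (fun t => w (t, y)) x (partial 0 w (x, y))).
  { intros x y. apply Derive_correct.
    exact (is_Ck_ex_partial 1 w 0 (x, y) Hw ltac:(lia)). }
  assert (D1 : forall x y, is_derive (fun t => w (x, t)) y (partial 1 w (x, y))).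
  { intros x y. apply Derive_correct.
    exact (is_Ck_ex_partial 1 w 1 (x, y) Hw ltac:(lia)). }
  assert (D00 : forall x y, is_derive (fun t => partial 0 w (t, y)) x
                              (partial 0 (partial 0 w) (x, y))).
  { intros x y. apply Derive_correct.
    exact (is_Ck_ex_partial 0 _ 0 (x, y) Hw0 ltac:(lia)). }
  assert (D11 : forall x y, is_derive (fun t => partial 1 w (x, t)) y
                              (partial 1 (partial 1 w) (x, y))).
  { intros x y. apply Derive_correct.
    exact (is_Ck_ex_partial 0 _ 1 (x, y) Hw1 ltac:(lia)). }
  (* [e] is the squared gradient of [w], and [d] is the derivative of [w * partial 0 w] in the first
     variable. [F] below is half of the derivative of the integral of [w ^ 2] over the second
     variable. *)
  set (e := fun z : R * R => partial 0 w z * partial 0 w z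
                             + partial 1 w z * partial 1 w z).
  set (d := fun z : R * R => partial 0 w z * partial 0 w z
                             + w z * partial 0 (partial 0 w) z).
  assert (Ce : forall z, continuous e z).
  { unfold e. prove_continuous. }
  assert (Cd : forall z, continuous d z).
  { unfold d. prove_continuous. }
  set (F := fun x => RInt (fun y => w (x, y) * partial 0 w (x, y)) 0 P).
  assert (Dint : forall x y, is_derive (fun t => w (t, y) * partial 0 w (t, y)) x (d (x, y))).
  { intros x y.
    exact (is_derive_mult (fun t => w (t, y)) (fun t => partial 0 w (t, y)) x
            _ _ (D0 x y) (D00 x y) Rmult_comm). }
  assert (DF : forall x, is_derive F x (RInt (fun y => d (x, y)) 0 P)).
  { intros x. unfold F.
    evar_last.
    (* Differentiation under the integral sign; the joint continuity it asks for is that of [d]. *)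
    - apply (is_derive_RInt_param (fun x y => w (x, y) * partial 0 w (x, y))).
      + apply filter_forall. intros u t _. eexists. apply Dint.
      + intros t _. apply continuity_2d_continuous.
        apply continuous_ext with (f := d); [|apply Cd].
        intros [u v]. symmetry. apply is_derive_unique. apply Dint.
      + apply filter_forall. intros u. apply ex_RInt_continuous_everywhere.
        intros v.
        apply (continuous_snd_slice (fun z => w z * partial 0 w z)).
        prove_continuous.
    - apply RInt_ext_R. intros y. apply is_derive_unique. apply Dint. }
  assert (Ide : forall x, RInt (fun y => d (x, y)) 0 P = RInt (fun y => e (x, y)) 0 P).
  { intros x.
    (* By the equation for [w], the difference [d - e] equals [w * (b * partial 1 w - partial 1
       (partial 1 w)) - (partial 1 w) ^ 2]. Since [b] is constant along the slice, this is the exact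
       derivative [dq] of [q], and its integral over a period vanishes. *)
    set (q := fun y => b x / 2 * (w (x, y) * w (x, y)) + -1 * (w (x, y) * partial 1 w (x, y))).
    set (dq := fun y => b x * (w (x, y) * partial 1 w (x, y))
      + -1 * (partial 1 w (x, y) * partial 1 w (x, y)
              + w (x, y) * partial 1 (partial 1 w) (x, y))).
    assert (Dq : forall y, is_derive q y (dq y)).
    { intros y.
      (* The slices of [w] and [partial 1 w] are abstracted to plain functions so that [auto_derive]
         does not look inside them. *)
      assert (Dgen : forall (f g : R -> R) df dg, is_derive f y df -> is_derive g y dg ->
        is_derive (fun t => b x / 2 * (f t * f t) + -1 * (f t * g t)) y
          (b x * (f y * df) + -1 * (df * g y + f y * dg))).
      { intros f g df dg Df Dg. auto_derive.
        - repeat split; eexists; eassumption.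
        - apply is_derive_unique in Df, Dg.
          change (Derive (fun t : R => f t) y) with (Derive f y).
          change (Derive (fun t : R => g t) y) with (Derive g y).
          rewrite Df, Dg. field. }
      exact (Dgen _ _ _ _ (D1 x y) (D11 x y)). }
    assert (Cdq : forall y, continuous dq y).
    { intros y.
      assert (continuous (fun y => w (x, y)) y) by now apply continuous_snd_slice.
      assert (continuous (fun y => partial 1 w (x, y)) y) by now apply continuous_snd_slice.
      assert (continuous (fun y => partial 1 (partial 1 w) (x, y)) y)
        by now apply continuous_snd_slice.
      unfold dq. prove_continuous. }
    assert (Idq : RInt dq 0 P = 0).
    { rewrite (is_RInt_unique dq 0 P (minus (q P) (q 0))).
      - pose proof (proj2 (Hper x 0)) as E.
        pose proof (proj2 (partial_periodic P w 1 Hper ltac:(lia) x 0)) as E1.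
        rewrite Rplus_0_l in E, E1.
        unfold q. rewrite E, E1. apply (minus_eq_zero (G := R_AbelianGroup)).
      - apply (is_RInt_derive q dq); auto. }
    transitivity (RInt (fun y => e (x, y)) 0 P + RInt dq 0 P); [|rewrite Idq; apply Rplus_0_r].
    rewrite <- RInt_plus_R; [|intros; now apply continuous_snd_slice | assumption].
    apply RInt_ext_R. intros y. unfold e, d, dq.
    pose proof (Heq (x, y)) as E. simpl in E.
    replace (partial 0 (partial 0 w) (x, y))
      with (b x * partial 1 w (x, y) - partial 1 (partial 1 w) (x, y)) by lra.
    ring. }
  assert (epos : forall z, 0 <= e z) by (intros z; unfold e; nra).
  assert (FP : F 0 = F P).
  { unfold F. apply RInt_ext_R. intros y.
    pose proof (proj1 (Hper 0 y)) as E.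
    pose proof (proj1 (partial_periodic P w 0 Hper ltac:(lia) 0 y)) as E1.
    rewrite Rplus_0_l in E, E1. now rewrite E, E1. }
  intros x y Hx Hy.
  (* [F] takes equal values at 0 and [P] and has the nonnegative derivative [RInt e], so this
     integral vanishes at every interior [x]; then [e] vanishes pointwise, and with it both
     squares. *)
  assert (F0 : RInt (fun y => e (x, y)) 0 P = 0).
  { apply (nonneg_derive_eq_endpoints F (fun x => RInt (fun y => e (x, y)) 0 P) 0 P);
      auto.
    - intros t. rewrite <- Ide. apply DF.
    - intros t. apply RInt_ge_0; [lra | |auto].
      apply ex_RInt_continuous_everywhere. intros; now apply continuous_snd_slice. }
  assert (E0 : e (x, y) = 0).
  { apply (RInt_nonneg_zero (fun y => e (x, y)) 0 P); auto.
    intros; now apply continuous_snd_slice. }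
  unfold e in E0. split; nra.
Qed.

(** The shape of [Gamma0] with an arbitrary profile, so that the cell problem is solved before the
    scales enter. *)
Definition shear (H : R -> R) (x : R * R) : matrix (T := R) 2 2 :=
  mk_matrix 2 2 (fun i j =>
    match i, j with
    | 0%nat, 1%nat => H (fst x)
    | 1%nat, 0%nat => - H (fst x)
    | _, _ => 0
    end).

Lemma partial_dot (l x : R * R) (i : nat) :
  (i < 2)%nat -> is_derive (section i (dot l) x) (coord x i) (coord l i).
Proof.
  intros Hi. destruct i as [|[|i]]; [| |lia]; unfold section, dot, sum2; simpl;
    auto_derive; auto; ring.
Qed.

(** The diagonal entries are zero and the terms with mixed second derivatives of [chi] cancel. What
    remains of the flow is first order: a drift in the second direction with coefficient
    [Derive H]. *)
Lemma L_shear (H : R -> R) (l : R * R) (chi : R * R -> R) (x : R * R) :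
  smooth H -> is_Ck 2 chi ->
  L (shear H) (fun y => chi y - dot l y) x
  = 1 / 2 * (partial 0 (partial 0 chi) x + partial 1 (partial 1 chi) x)
    - Derive H (fst x) * (partial 1 chi x - snd l).
Proof.
  intros HH Hchi.
  assert (P1 : forall i, (i < 2)%nat -> partial i (fun y => chi y - dot l y)
                 = fun y => partial i chi y - coord l i).
  { intros i Hi. apply functional_extensionality. intros y.
    rewrite partial_minus; auto.
    - f_equal. apply is_derive_unique. now apply partial_dot.
    - now apply (is_Ck_ex_partial 1).
    - eexists. now apply partial_dot. }
  assert (X : forall i j y, (i < 2)%nat -> (j < 2)%nat -> ex_partial i (partial j chi) y).
  { intros i j y Hi Hj. apply (is_Ck_ex_partial 0); [|assumption].
    now apply is_Ck_partial. }
  unfold L, sum2. rewrite !P1 by lia.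
  (* The matrix entries reduce by computation to [0], [H], [- H] and [0]. *)
  match goal with |- _ = ?rhs => change (
    1 / 2 * (partial 0 (fun y => partial 0 chi y - coord l 0) x
             + partial 1 (fun y => partial 1 chi y - coord l 1) x)
    - (partial 0 (fun y => 0 * (partial 0 chi y - coord l 0)) x
       + partial 0 (fun y => H (fst y) * (partial 1 chi y - coord l 1)) x
       + (partial 1 (fun y => - H (fst y) * (partial 0 chi y - coord l 0)) x
          + partial 1 (fun y => 0 * (partial 1 chi y - coord l 1)) x)) = rhs) end.
  assert (Z : forall i (g : R * R -> R), (i < 2)%nat -> partial i (fun y => 0 * g y) x = 0).
  { intros i g Hi. replace (fun y => 0 * g y) with (fun _ : R * R => 0)
      by (apply functional_extensionality; intros; ring).
    now rewrite partial_const. }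
  rewrite (Z 0%nat (fun y => partial 0 chi y - coord l 0)),
          (Z 1%nat (fun y => partial 1 chi y - coord l 1)) by lia.
  assert (S : forall i j, (i < 2)%nat -> (j < 2)%nat ->
     partial i (fun y => partial j chi y - coord l j) x = partial i (partial j chi) x).
  { intros i j Hi Hj. rewrite (partial_minus i (partial j chi) (fun _ => coord l j)); auto.
    - rewrite (partial_const i (coord l j)) by assumption. ring.
    - destruct i as [|[|i]]; [| |lia]; apply ex_derive_const. }
  rewrite !S by lia.
  assert (T0 : partial 0 (fun y => H (fst y) * (partial 1 chi y - coord l 1)) x
    = Derive H (fst x) * (partial 1 chi x - coord l 1)
      + H (fst x) * partial 0 (partial 1 chi) x).
  { apply is_derive_unique.
    assert (A := Derive_correct _ _ (X 0%nat 1%nat x ltac:(lia) ltac:(lia))).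
    pose proof (is_derive_mult H (fun t => partial 1 chi (t, snd x) - coord l 1) (fst x)
      (Derive H (fst x)) (partial 0 (partial 1 chi) x)) as M.
    destruct x as [x y]. apply M.
    - now apply smooth_is_derive.
    - evar_last.
      { apply (is_derive_minus _ (fun _ => coord l 1));
          [exact A | apply is_derive_const]. }
      apply Rminus_0_r.
    - exact Rmult_comm. }
  (* Along the second coordinate [H (fst y)] is constant and factors out; only [T0] produces a
     derivative of [H]. *)
  assert (T1 : partial 1 (fun y => - H (fst y) * (partial 0 chi y - coord l 0)) x
    = - H (fst x) * partial 1 (partial 0 chi) x).
  { rewrite <- (S 1%nat 0%nat) by lia.
    exact (Derive_scal (section 1 (fun y => partial 0 chi y - coord l 0) x)
            (- H (fst x)) (snd x)). }
  rewrite T0, T1, partial_comm by assumption. simpl. ring.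
Qed.

(** * The explicit corrector of a shear flow *)

Lemma RInt_minus_mean (H : R -> R) (P : R) :
  P <> 0 -> (forall x, continuous H x) ->
  RInt (fun x => H x - RInt H 0 P / P) 0 P = 0.
Proof.
  intros HP HH.
  rewrite (RInt_ext_R _ (fun x => H x + - (RInt H 0 P / P))) by (intros; ring).
  rewrite RInt_plus_R, RInt_const_R; auto.
  - eq_in_R. field. exact HP.
  - intros; apply continuous_const.
Qed.

Definition centered (H : R -> R) (P x : R) : R := H x - RInt H 0 P / P.

Lemma centered_smooth (H : R -> R) (P : R) : smooth H -> smooth (centered H P).
Proof.
  intros Hs. apply (smooth_plus H (fun _ => - (RInt H 0 P / P)));
    [exact Hs | apply smooth_const].
Qed.

(** For a function of the first coordinate alone the cell equation reads [chi'' = -2 * snd l * H'].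
    Integrating once leaves a free constant, and subtracting the mean of [H] is the choice that
    makes [chi] periodic; starting the integral at 0 gives [chi (0, 0) = 0]. *)
Definition shear_corrector (H : R -> R) (P : R) (l x : R * R) : R :=
  -2 * snd l * RInt (centered H P) 0 (fst x).

Lemma shear_corrector_derive (H : R -> R) (P k x : R) :
  smooth H ->
  is_derive (fun t => k * RInt (centered H P) 0 t) x (k * centered H P x).
Proof.
  intros Hs.
  apply (is_derive_scal (fun t => RInt (centered H P) 0 t)).
  apply is_derive_RInt_continuous.
  intros; now apply smooth_continuous, centered_smooth.
Qed.

Lemma shear_corrector_is_Ck (n : nat) (H : R -> R) (P : R) (l : R * R) :
  smooth H -> is_Ck n (shear_corrector H P l).
Proof.
  intros Hs. apply (is_Ck_fst n (fun t => -2 * snd l * RInt (centered H P) 0 t)).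
  apply smooth_of_Derive.
  - intros x. eexists. now apply shear_corrector_derive.
  - replace (Derive _) with (fun x => -2 * snd l * centered H P x).
    + now apply smooth_scal, centered_smooth.
    + apply functional_extensionality. intros x. symmetry.
      now apply is_derive_unique, shear_corrector_derive.
Qed.

Lemma shear_corrector_partial0 (H : R -> R) (P : R) (l : R * R) :
  smooth H ->
  partial 0 (shear_corrector H P l) = fun x => -2 * snd l * centered H P (fst x).
Proof.
  intros Hs. apply functional_extensionality. intros x.
  now apply is_derive_unique, shear_corrector_derive.
Qed.

Lemma shear_corrector_partial1 (H : R -> R) (P : R) (l : R * R) :
  partial 1 (shear_corrector H P l) = fun _ => 0.
Proof. exact (partial_1_fst (fun t => -2 * snd l * RInt (centered H P) 0 t)). Qed.

Lemma shear_corrector_partial00 (H : R -> R) (P : R) (l x : R * R) :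
  smooth H ->
  partial 0 (partial 0 (shear_corrector H P l)) x = -2 * snd l * Derive H (fst x).
Proof.
  intros Hs. rewrite shear_corrector_partial0 by exact Hs.
  apply is_derive_unique. apply (is_derive_scal (centered H P)).
  evar_last.
  { apply (is_derive_minus H (fun _ => RInt H 0 P / P)).
    - now apply smooth_is_derive.
    - apply is_derive_const. }
  apply Rminus_0_r.
Qed.

(** Cut the integral at [P]: the first full period contributes zero because the integrand is
    centered, and the rest shifts back by one period. *)
Lemma shear_corrector_periodic (H : R -> R) (P : R) (l : R * R) :
  P <> 0 -> smooth H -> (forall x, H (x + P) = H x) ->
  periodic2 P (shear_corrector H P l).
Proof.
  intros HP Hs Hper x y; split; [|reflexivity].
  unfold shear_corrector; simpl. f_equal.
  assert (C : forall t, continuous (centered H P) t)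
    by (intros; now apply smooth_continuous, centered_smooth).
  rewrite (RInt_Chasles_R (centered H P) 0 P) by exact C.
  unfold centered at 1.
  rewrite RInt_minus_mean; [|exact HP|intros; now apply smooth_continuous].
  pose proof (RInt_shift (centered H P) P 0 x C) as E.
  rewrite Rplus_0_l in E. rewrite E; [apply Rplus_0_l|].
  intros t. unfold centered. now rewrite Hper.
Qed.

Lemma shear_corrector_is_cell_solution (H : R -> R) (P : R) (l : R * R) :
  P <> 0 -> smooth H -> (forall x, H (x + P) = H x) ->
  is_cell_solution (shear H) P l (shear_corrector H P l).
Proof.
  intros HP Hs Hper.
  assert (C2 : is_Ck 2 (shear_corrector H P l)) by now apply shear_corrector_is_Ck.
  split; [exact C2|]. split; [now apply shear_corrector_periodic|]. split.
  - unfold shear_corrector; simpl.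
    rewrite RInt_point_R.
    apply Rmult_0_r.
  - intros x. rewrite L_shear by assumption.
    rewrite shear_corrector_partial00 by assumption.
    rewrite shear_corrector_partial1, partial_const by lia. field.
Qed.

(** The explicit corrector shows that solutions exist, so the function picked by [epsilon] is one.
    Its gradient then agrees with that of the corrector by uniqueness. The open square suffices for
    the energy integral. *)
Lemma cell_solution_gradient (H : R -> R) (P : R) (l : R * R) (x y : R) :
  0 < P -> smooth H -> (forall x, H (x + P) = H x) ->
  0 < x < P -> 0 < y < P ->
  partial 0 (cell_solution (shear H) P l) (x, y)
    = -2 * snd l * (H x - RInt H 0 P / P) /\
  partial 1 (cell_solution (shear H) P l) (x, y) = 0.
Proof.
  intros HP Hs Hper Hx Hy.
  assert (HP0 : P <> 0) by lra.
  assert (Sol : is_cell_solution (shear H) P l (cell_solution (shear H) P l)).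
  { unfold cell_solution. apply epsilon_spec. exists (shear_corrector H P l).
    now apply shear_corrector_is_cell_solution. }
  destruct Sol as [C2 [Per [_ Eq]]].
  destruct (shear_corrector_is_cell_solution H P l HP0 Hs Hper) as [C2' [Per' [_ Eq']]].
  set (cell := shear_corrector H P l) in *.
  set (chi := cell_solution (shear H) P l) in *.
  assert (Dw : forall i z, (i < 2)%nat ->
    partial i (fun z => chi z - cell z) z = partial i chi z - partial i (cell) z).
  { intros i z Hi. apply partial_minus; auto; now apply (is_Ck_ex_partial 1). }
  assert (Dww : forall i z, (i < 2)%nat ->
    partial i (partial i (fun z => chi z - cell z)) z
    = partial i (partial i chi) z - partial i (partial i (cell)) z).
  { intros i z Hi.
    replace (partial i (fun z => chi z - cell z))
      with (fun z => partial i chi z - partial i (cell) z)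
      by (apply functional_extensionality; intros; symmetry; auto).
    apply partial_minus; auto; apply (is_Ck_ex_partial 0); auto;
      now apply is_Ck_partial. }
  (* Subtracting the two cell equations removes the source term; multiplying by 2 leaves the
     Laplacian of the difference equal to [2 * Derive H] times its second partial derivative. *)
  destruct (periodic_drift_gradient_zero P (fun z => chi z - cell z)
              (fun t => 2 * Derive H t) HP) with (x := x) (y := y) as [G0 G1]; auto.
  - now apply is_Ck_minus.
  - intros a b. now rewrite !(proj1 (Per a b)), !(proj2 (Per a b)),
      (proj1 (Per' a b)), (proj2 (Per' a b)).
  - intros z. rewrite !Dww, Dw by lia.
    pose proof (Eq z) as E. pose proof (Eq' z) as E'.
    rewrite L_shear in E, E' by assumption. lra.
  - rewrite Dw in G0, G1 by lia.
    unfold cell in G0, G1. rewrite shear_corrector_partial0 in G0 by exact Hs.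
    rewrite shear_corrector_partial1 in G1. unfold centered in G0. simpl in G0.
    split; lra.
Qed.

(** The integrand is [(fst l + 2 * snd l * (H x - m)) ^ 2 + snd l ^ 2], independent of the second
    coordinate; its cross term integrates to zero because [m] is the mean of [H]. *)
Lemma cell_energy_shear (H : R -> R) (P : R) (l : R * R) :
  0 < P -> smooth H -> (forall x, H (x + P) = H x) ->
  cell_energy (shear H) P l
  = fst l ^ 2
    + snd l ^ 2 * (1 + 4 * (RInt (fun x => (H x - RInt H 0 P / P) ^ 2) 0 P / P)).
Proof.
  intros HP Hs Hper. unfold cell_energy.
  set (m := RInt H 0 P / P).
  assert (CH : forall x, continuous H x) by (intros; now apply smooth_continuous).
  (* The gradient is known only inside the open square, and [RInt_ext] asks for equality only
     strictly between the bounds. *)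
  rewrite (RInt_ext (V := R_CompleteNormedModule) _ (fun x =>
     P * (fst l ^ 2 + snd l ^ 2)
     + (4 * P * fst l * snd l * (H x - m) + 4 * P * snd l ^ 2 * (H x - m) ^ 2))).
  - rewrite RInt_plus_R, RInt_plus_R, !RInt_scal_R, RInt_const_R;
      [| prove_continuous ..].
    unfold m at 1. rewrite RInt_minus_mean; [|lra|exact CH].
    eq_in_R. field. lra.
  - intros x Hx. rewrite Rmin_left, Rmax_right in Hx by lra.
    rewrite (RInt_ext (V := R_CompleteNormedModule) _
       (fun _ => (fst l + 2 * snd l * (H x - m)) ^ 2 + snd l ^ 2)).
    + rewrite RInt_const_R. eq_in_R. ring.
    + intros y Hy. rewrite Rmin_left, Rmax_right in Hy by lra.
      destruct (cell_solution_gradient H P l x y HP Hs Hper Hx Hy) as [G0 G1].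
      unfold sum2. rewrite G0, G1. fold m. eq_in_R. simpl. ring.
Qed.

Lemma effective_diffusivity_shear (H : R -> R) (P : R) :
  0 < P -> smooth H -> (forall x, H (x + P) = H x) ->
  entry (effective_diffusivity (shear H) P) 1 1
  = 1 + 4 * (RInt (fun x => (H x - RInt H 0 P / P) ^ 2) 0 P / P).
Proof.
  intros HP Hs Hper. set (V := RInt (fun x => (H x - RInt H 0 P / P) ^ 2) 0 P / P).
  assert (S : is_effective_diffusivity (shear H) P (effective_diffusivity (shear H) P)).
  { unfold effective_diffusivity. apply epsilon_spec.
    (* The energy is the quadratic form of this diagonal matrix, so the choice made by [epsilon] is
       a genuine one; testing it with [l = (0, 1)] then isolates the required entry. *)
    exists (mk_matrix 2 2 (fun i j =>
      match i, j with 0%nat, 0%nat => 1 | 1%nat, 1%nat => 1 + 4 * V | _, _ => 0 end)).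
    split; [reflexivity|]. intros l. rewrite cell_energy_shear by assumption. fold V.
    unfold sum2, entry, coeff_mat, mk_matrix. simpl. ring. }
  destruct S as [_ S]. specialize (S (0, 1)).
  rewrite cell_energy_shear in S by assumption. fold V in S.
  unfold sum2 in S. simpl in S. lra.
Qed.

(** * Correlation of well separated scales *)

Lemma periodic_multiple (f : R -> R) (P x : R) (m : nat) :
  (forall t, f (t + P) = f t) -> f (x + INR m * P) = f x.
Proof.
  intros Hf. induction m as [|m IH].
  - f_equal. simpl. ring.
  - rewrite S_INR. replace (x + (INR m + 1) * P) with (x + INR m * P + P) by ring.
    now rewrite Hf.
Qed.

Lemma RInt_period_at_multiple (f : R -> R) (P : R) (m : nat) :
  (forall x, continuous f x) -> (forall x, f (x + P) = f x) ->
  RInt f (INR m * P) (INR (S m) * P) = RInt f 0 P.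
Proof.
  intros Hc Hf. rewrite <- (RInt_shift f (INR m * P) 0 P).
  - f_equal; [|rewrite S_INR]; ring.
  - exact Hc.
  - intros x. now apply periodic_multiple.
Qed.

Lemma RInt_multiple (f : R -> R) (P : R) (m : nat) :
  (forall x, continuous f x) -> (forall x, f (x + P) = f x) ->
  RInt f 0 (INR m * P) = INR m * RInt f 0 P.
Proof.
  intros Hc Hf. induction m as [|m IH].
  - simpl. rewrite !Rmult_0_l. apply RInt_point_R.
  - rewrite (RInt_Chasles_R f 0 (INR m * P)), IH, RInt_period_at_multiple by assumption.
    rewrite S_INR. eq_in_R. ring.
Qed.

Lemma RInt_le_R (f g : R -> R) (a b : R) :
  a <= b -> (forall x, continuous f x) -> (forall x, continuous g x) ->
  (forall x, a < x < b -> f x <= g x) -> RInt f a b <= RInt g a b.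
Proof.
  intros; apply RInt_le; auto; now apply ex_RInt_continuous_everywhere.
Qed.

(* On each period of [f], which has mean zero, [g] may be replaced by its
   increment from the left endpoint. *)
Lemma correlation_bound (f g : R -> R) (P Lam : R) (m : nat) :
  0 < P -> (forall x, continuous f x) -> (forall x, continuous g x) ->
  (forall x, f (x + P) = f x) -> RInt f 0 P = 0 ->
  (forall x y, Rabs (g x - g y) <= Lam * Rabs (x - y)) ->
  Rabs (RInt (fun x => f x * g x) 0 (INR m * P))
    <= INR m * (Lam * P * RInt (fun x => Rabs (f x)) 0 P).
Proof.
  intros HP Cf Cg Pf If Lg.
  (* The Lipschitz bound between 1 and 0 forces its constant to be nonnegative. *)
  assert (HL : 0 <= Lam).
  { pose proof (Lg 1 0) as H. pose proof (Rabs_pos (g 1 - g 0)).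
    replace (1 - 0) with 1 in H by ring. rewrite Rabs_R1 in H. lra. }
  induction m as [|m IH].
  - simpl. rewrite !Rmult_0_l.
    rewrite RInt_point_R, Rabs_R0. lra.
  - rewrite (RInt_Chasles_R _ 0 (INR m * P)) by prove_continuous.
    eapply Rle_trans; [apply Rabs_triang|].
    set (a := INR m * P) in *. set (b := INR (S m) * P).
    assert (Hab : b = a + P) by (unfold a, b; rewrite S_INR; ring).
    assert (E : RInt (fun x => f x * g x) a b = RInt (fun x => f x * (g x - g a)) a b).
    { rewrite (RInt_ext_R (fun x => f x * g x)
        (fun x => f x * (g x - g a) + g a * f x)) by (intros; ring).
      rewrite RInt_plus_R, RInt_scal_R by prove_continuous.
      unfold a, b. rewrite (RInt_period_at_multiple f), If by assumption.
      eq_in_R. ring. }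
    assert (B : Rabs (RInt (fun x => f x * (g x - g a)) a b)
                <= Lam * P * RInt (fun x => Rabs (f x)) 0 P).
    { eapply Rle_trans.
      - apply abs_RInt_le; [lra|].
        apply ex_RInt_continuous_everywhere. prove_continuous.
      - rewrite <- (RInt_period_at_multiple (fun x => Rabs (f x)) P m);
          [|prove_continuous | intros; now rewrite Pf].
        fold a b. rewrite <- RInt_scal_R by prove_continuous.
        apply RInt_le_R; [lra | prove_continuous | prove_continuous |].
        (* Between [a] and [a + P] the distance to [a] is at most [P], so [g] moves by at most
           [Lam * P]. *)
        intros x Hx. rewrite Rabs_mult, Rmult_comm.
        apply Rmult_le_compat_r; [apply Rabs_pos|].
        eapply Rle_trans; [apply Lg|].
        apply Rmult_le_compat_l; [exact HL|]. rewrite Rabs_right; lra. }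
    rewrite E, S_INR. lra.
Qed.

Lemma RInt_rescale (f : R -> R) (Q : R) :
  0 < Q -> (forall x, continuous f x) ->
  RInt (fun x => f (x / Q)) 0 Q = Q * RInt f 0 1.
Proof.
  intros HQ Cf.
  pose proof (RInt_comp_lin f (/ Q) 0 0 Q) as E.
  replace (/ Q * 0 + 0) with 0 in E by ring.
  replace (/ Q * Q + 0) with 1 in E by (field; lra).
  assert (Cg : forall x, continuous (fun x => f (x / Q)) x).
  { intros x. apply (continuous_comp (fun x => x / Q) f); [|apply Cf].
    apply (continuous_mult_R (fun x => x) (fun _ => / Q));
      [apply continuous_id | apply continuous_const]. }
  rewrite <- E by now apply ex_RInt_continuous_everywhere.
  rewrite <- RInt_scal_R.
  - apply RInt_ext_R. intros x. unfold scal; simpl; unfold mult; simpl.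
    replace (/ Q * x + 0) with (x / Q) by (field; lra). field. lra.
  - intros x. apply (continuous_scal_r (K := R_AbsRing) (V := R_NormedModule)).
    apply continuous_ext with (f := fun x => f (x / Q)); [|apply Cg].
    intros y. f_equal. field. lra.
Qed.

(** * Adding one scale to a centered periodic profile *)

Record oscillation (P : R) (f : R -> R) : Prop := {
  osc_continuous : forall x, continuous f x;
  osc_periodic : forall x, f (x + P) = f x;
  osc_mean : RInt f 0 P = 0 }.

Definition variance (P : R) (f : R -> R) : R := RInt (fun x => f x ^ 2) 0 P / P.
Definition abs_mean (P : R) (f : R -> R) : R := RInt (fun x => Rabs (f x)) 0 P / P.

(** Integrate the pointwise inequality [Rabs t <= (1 + t ^ 2) / 2]; the right side has integral
    1. *)
Lemma abs_mean_unit (phi : R -> R) :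
  oscillation 1 phi -> variance 1 phi = 1 -> abs_mean 1 phi <= 1.
Proof.
  intros [Cp _ _] V. unfold variance, abs_mean in *. rewrite Rdiv_1_r in *.
  replace 1 with (RInt (fun x => / 2 * (1 + phi x ^ 2)) 0 1) at 2.
  - apply RInt_le_R; [lra | prove_continuous | prove_continuous |].
    intros x _. pose proof (pow2_ge_0 (Rabs (phi x) - 1)) as H.
    rewrite <- (pow2_abs (phi x)). nra.
  - rewrite RInt_scal_R, RInt_plus_R, RInt_const_R, V by prove_continuous.
    eq_in_R. field.
Qed.

(** The new period [Q] holds [m] periods of [f] and one of the rescaled [phi]. In the square of the
    sum, [f ^ 2] gives the old variance, the square of the new term gives [c ^ 2], and the cross
    term is small because the new term varies slowly over a period of [f]. The bound on [abs_mean]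
    lets the step be iterated. *)
Lemma variance_add_scale (f phi : R -> R) (P c K : R) (m : nat) :
  0 < P -> (0 < m)%nat -> 0 <= c ->
  oscillation P f -> oscillation 1 phi -> variance 1 phi = 1 ->
  (forall x y, Rabs (phi x - phi y) <= K * Rabs (x - y)) ->
  let Q := INR m * P in
  let F := fun x => f x + c * phi (x / Q) in
  oscillation Q F /\ abs_mean Q F <= abs_mean P f + c /\
  Rabs (variance Q F - variance P f - c ^ 2)
    <= 2 * c * (K / INR m) * abs_mean P f.
Proof.
  intros HP Hm Hc [Cf Pf If] Hphi V Lip Q F.
  pose proof (abs_mean_unit phi Hphi V) as A1.
  destruct Hphi as [Cp Pp Ip].
  assert (Hm' : 0 < INR m) by now apply lt_0_INR.
  assert (HQ : 0 < Q) by now apply Rmult_lt_0_compat.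
  assert (Cq : forall x, continuous (fun x => phi (x / Q)) x).
  { intros x. apply (continuous_comp (fun x => x / Q) phi); [|apply Cp].
    apply (continuous_mult_R (fun x => x) (fun _ => / Q));
      [apply continuous_id | apply continuous_const]. }
  assert (CF : forall x, continuous F x) by (unfold F; prove_continuous).
  unfold variance, abs_mean in *. rewrite Rdiv_1_r in *.
  split; [split|split].
  - exact CF.
  - intros x. unfold F. f_equal; [now apply periodic_multiple|]. f_equal.
    replace ((x + Q) / Q) with (x / Q + 1) by (field; lra). apply Pp.
  - unfold F. rewrite RInt_plus_R, RInt_scal_R by prove_continuous.
    unfold Q at 1. rewrite RInt_multiple, If, RInt_rescale, Ip by assumption.
    eq_in_R. ring.
  - apply Rle_trans with
      (RInt (fun x => Rabs (f x) + c * Rabs (phi (x / Q))) 0 Q / Q).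
    + apply Rmult_le_compat_r; [left; now apply Rinv_0_lt_compat|].
      apply RInt_le_R; [lra | prove_continuous | prove_continuous |].
      intros x _. unfold F. eapply Rle_trans; [apply Rabs_triang|].
      rewrite Rabs_mult, (Rabs_right c); lra.
    + rewrite RInt_plus_R, RInt_scal_R by prove_continuous.
      unfold Q at 1. rewrite RInt_multiple; [|prove_continuous|intros; now rewrite Pf].
      rewrite (RInt_rescale (fun x => Rabs (phi x))) by prove_continuous.
      set (u := RInt (fun x => Rabs (f x)) 0 P) in *.
      set (v := RInt (fun x => Rabs (phi x)) 0 1) in *.
      replace ((INR m * u + c * (Q * v)) / Q) with (u / P + c * v)
        by (unfold Q; field; lra).
      nra.
  - assert (E : RInt (fun x => F x ^ 2) 0 Q
      = INR m * RInt (fun x => f x ^ 2) 0 P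
        + (c ^ 2 * Q + 2 * c * RInt (fun x => f x * phi (x / Q)) 0 Q)).
    { rewrite (RInt_ext_R (fun x => F x ^ 2)
        (fun x => f x ^ 2 + (c ^ 2 * phi (x / Q) ^ 2 + 2 * c * (f x * phi (x / Q)))))
        by (intros; unfold F; ring).
      rewrite RInt_plus_R, RInt_plus_R, !RInt_scal_R by prove_continuous.
      rewrite <- RInt_multiple; [|prove_continuous|intros; now rewrite Pf].
      rewrite (RInt_rescale (fun x => phi x ^ 2)), V by prove_continuous.
      eq_in_R. fold Q. ring. }
    rewrite E.
    (* Rescaling by [Q] divides the Lipschitz constant of [phi] by [Q]; since [Q = INR m * P], the
       relative gain is [K / INR m]. *)
    pose proof (correlation_bound f (fun x => phi (x / Q)) P (K / Q) m HP Cf Cq Pf If) as B.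
    fold Q in B.
    set (u := RInt (fun x => f x * phi (x / Q)) 0 Q) in *.
    set (v := RInt (fun x => Rabs (f x)) 0 P) in *.
    set (w := RInt (fun x => f x ^ 2) 0 P).
    replace ((INR m * w + (c ^ 2 * Q + 2 * c * u)) / Q - w / P - c ^ 2)
      with (2 * c / Q * u) by (unfold Q; field; lra).
    assert (Hk : 0 <= 2 * c / Q).
    { apply Rmult_le_pos; [lra | left; now apply Rinv_0_lt_compat]. }
    rewrite Rabs_mult, (Rabs_right (2 * c / Q)) by lra.
    replace (2 * c * (K / INR m) * (v / P))
      with (2 * c / Q * (INR m * (K / Q * P * v))) by (unfold Q; field; lra).
    apply Rmult_le_compat_l; [exact Hk|]. apply B.
    intros x y. eapply Rle_trans; [apply Lip|].
    replace (x / Q - y / Q) with ((x - y) / Q) by (field; lra).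
    unfold Rdiv. rewrite Rabs_mult, (Rabs_right (/ Q)).
    + right; ring.
    + left; now apply Rinv_0_lt_compat.
Qed.

Lemma mean_value_bound (f : R -> R) (K x y : R) :
  smooth f -> (forall t, Rabs (Derive f t) <= K) ->
  Rabs (f x - f y) <= K * Rabs (x - y).
Proof.
  intros Hs HK.
  destruct (MVT_gen f y x (Derive f)) as [c [_ Hc]].
  - intros; now apply smooth_is_derive.
  - intros t _. apply continuity_pt_filterlim. now apply smooth_continuous.
  - rewrite Hc, Rabs_mult. apply Rmult_le_compat_r; [apply Rabs_pos | apply HK].
Qed.

(** * Suprema and infima in the extended reals *)

Lemma Sup_seq_ub (u : nat -> Rbar) (n : nat) : Rbar_le (u n) (Sup_seq u).
Proof.
  apply (proj1 (is_sup_seq_lub u _ (Sup_seq_correct u))). now exists n.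
Qed.

Lemma Inf_seq_lb (u : nat -> Rbar) (n : nat) : Rbar_le (Inf_seq u) (u n).
Proof.
  apply (proj1 (is_inf_seq_glb u _ (Inf_seq_correct u))). now exists n.
Qed.

(** The lower bound [a] excludes [m_infty] and the term of index 0 excludes [p_infty], so [real]
    returns the true infimum and not a default value. *)
Lemma Inf_seq_finite (u : nat -> R) (a : R) :
  Rbar_le (Finite a) (Inf_seq (fun n => Finite (u n))) ->
  Inf_seq (fun n => Finite (u n)) = Finite (real (Inf_seq (fun n => Finite (u n))))
  /\ forall n, real (Inf_seq (fun n => Finite (u n))) <= u n.
Proof.
  intros Ha. pose proof (Inf_seq_lb (fun n => Finite (u n))) as H.
  destruct (Inf_seq _) as [l| |]; simpl in *;
    [now split | exact (False_ind _ (H 0%nat)) | easy].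
Qed.

(** [K1 h] lies above a real number and below [p_infty], hence is finite, and [real] preserves
    it. *)
Lemma K1_bound (h : nat -> R -> R) (n : nat) (x : R) :
  Rbar_lt (K1 h) p_infty -> Rabs (Derive (h n) x) <= real (K1 h).
Proof.
  intros Hfin.
  assert (B : Rbar_le (Finite (Rabs (Derive (h n) x))) (K1 h)).
  { eapply Rbar_le_trans.
    - apply (proj1 (Lub_Rbar_correct (fun y => exists x, y = Rabs (Derive (h n) x)))).
      now exists x.
    - apply (Sup_seq_ub (fun n => sup_fun (fun x => Rabs (Derive (h n) x)))). }
  destruct (K1 h); simpl in *; easy.
Qed.

(** * Variance of the multiscale shear *)

Definition fluctuation (h : nat -> R -> R) (n : nat) (x : R) : R :=
  h n x - RInt (h n) 0 1.

Lemma fluctuation_oscillation (h : nat -> R -> R) (n : nat) :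
  smooth (h n) -> (forall x, h n (x + 1) = h n x) ->
  oscillation 1 (fluctuation h n).
Proof.
  intros Hs Hp. unfold fluctuation.
  assert (C : forall x, continuous (h n) x) by (intros; now apply smooth_continuous).
  split.
  - prove_continuous.
  - intros x. now rewrite Hp.
  - pose proof (RInt_minus_mean (h n) 1 R1_neq_R0 C) as E.
    now rewrite Rdiv_1_r in E.
Qed.

(** Each profile is centered separately, so that every partial sum has mean zero over its own
    period, as the induction on scales requires. *)
Definition centered_H0 (r : nat -> Z) (gamma : nat -> R) (h : nat -> R -> R)
    (p : nat) (x : R) : R :=
  sum_f_R0 (fun n => gamma n * fluctuation h n (x / Defs.Rn r n)) p.

(** Growth by a factor [g] gives [(g - 1) * gamma k <= gamma (S k) - gamma k], and these
    inequalities telescope. *)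
Lemma scale_sum_bound (gamma : nat -> R) (g : R) (p : nat) :
  1 < g -> 0 <= gamma 0%nat -> (forall n, g * gamma n <= gamma (S n)) ->
  sum_f_R0 gamma p <= gamma (S p) / (g - 1).
Proof.
  intros Hg H0 Hgr. apply (Rmult_le_reg_r (g - 1)); [lra|].
  unfold Rdiv. rewrite Rmult_assoc, Rinv_l, Rmult_1_r by lra.
  induction p as [|p IH]; simpl.
  - pose proof (Hgr 0%nat). lra.
  - pose proof (Hgr (S p)). lra.
Qed.

Lemma Rn_pos (r : nat -> Z) (n : nat) :
  r 0%nat = 1%Z -> (forall n, 2 <= IZR (r (S n))) -> 0 < Defs.Rn r n.
Proof.
  intros H0 H. unfold Defs.Rn. induction n as [|n IH]; simpl.
  - rewrite H0. lra.
  - apply Rmult_lt_0_compat; [exact IH|]. specialize (H n). lra.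
Qed.

(** Induction on the scales. The bound on [abs_mean] is part of the induction because it controls
    the correlation with the next scale. *)
Lemma variance_multiscale (r : nat -> Z) (gamma : nat -> R) (h : nat -> R -> R)
    (rho g K : R) (p : nat) :
  r 0%nat = 1%Z -> 2 <= rho -> (forall n, rho <= IZR (r (S n))) ->
  gamma 0%nat = 1 -> 1 < g -> (forall n, g * gamma n <= gamma (S n)) ->
  (forall n, oscillation 1 (fluctuation h n)) ->
  (forall n, variance 1 (fluctuation h n) = 1) ->
  (forall n x y, Rabs (fluctuation h n x - fluctuation h n y) <= K * Rabs (x - y)) ->
  let f := centered_H0 r gamma h p in
  oscillation (Defs.Rn r p) f /\
  abs_mean (Defs.Rn r p) f <= sum_f_R0 gamma p /\
  Rabs (variance (Defs.Rn r p) f - sum_f_R0 (fun k => gamma k ^ 2) p)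
    <= 2 * K / (rho * (g - 1)) * sum_f_R0 (fun k => gamma k ^ 2) p.
Proof.
  intros r0 Hrho Hr g0 Hg Hgr Ho Hv Hl.
  assert (Hr2 : forall n, 2 <= IZR (r (S n))) by (intros n; specialize (Hr n); lra).
  assert (HK : 0 <= K).
  { pose proof (Hl 0%nat 1 0) as H.
    pose proof (Rabs_pos (fluctuation h 0 1 - fluctuation h 0 0)).
    replace (1 - 0) with 1 in H by ring. rewrite Rabs_R1 in H. lra. }
  assert (gpos : forall n, 0 < gamma n).
  { induction n as [|n IH]; [lra|]. specialize (Hgr n). nra. }
  assert (D : 0 < rho * (g - 1)) by (apply Rmult_lt_0_compat; lra).
  induction p as [|p IH]; cbv zeta in *.
  (* Scale 0 is added to the zero profile of period 1 with [m = 1]; that profile has zero absolute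
     mean, so no error arises. *)
  - assert (Z0 : oscillation 1 (fun _ => 0)).
    { split; [prove_continuous | reflexivity | rewrite RInt_const_R; apply Rmult_0_r]. }
    destruct (variance_add_scale (fun _ => 0) (fluctuation h 0) 1 (gamma 0%nat) K 1)
      as [O [A V]]; auto; try lra; try lia.
    assert (R0 : Defs.Rn r 0 = INR 1 * 1) by (unfold Defs.Rn; simpl; rewrite r0; ring).
    assert (EF : centered_H0 r gamma h 0
      = fun x => 0 + gamma 0%nat * fluctuation h 0 (x / (INR 1 * 1))).
    { apply functional_extensionality. intros x. unfold centered_H0.
      rewrite <- R0. simpl. ring. }
    rewrite EF, R0. simpl sum_f_R0. rewrite g0 in *.
    assert (A0 : abs_mean 1 (fun _ => 0) = 0).
    { unfold abs_mean. rewrite Rabs_R0, RInt_const_R. eq_in_R. field. }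
    assert (V0 : variance 1 (fun _ => 0) = 0).
    { unfold variance. rewrite RInt_const_R. eq_in_R. field. }
    rewrite A0, ?V0 in *. split; [exact O|]. split; [lra|].
    rewrite Rminus_0_r in V. eapply Rle_trans; [apply V|].
    rewrite Rmult_0_r. apply Rmult_le_pos; [|lra].
    apply Rmult_le_pos; [lra | left; now apply Rinv_0_lt_compat].
  - destruct IH as [O [A V]].
    (* The ratio of the periods, as the natural number of old periods in a new one. *)
    set (m := Z.to_nat (r (S p))).
    assert (Em : INR m = IZR (r (S p))).
    { unfold m. rewrite INR_IZR_INZ, Z2Nat.id; [reflexivity|].
      apply le_IZR. specialize (Hr2 p). simpl. lra. }
    assert (Hm : rho <= INR m) by (rewrite Em; apply Hr).
    assert (Hm0 : (0 < m)%nat) by (apply INR_lt; simpl; lra).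
    pose proof (Rn_pos r p r0 Hr2) as HP.
    destruct (variance_add_scale _ (fluctuation h (S p)) _ (gamma (S p)) K m HP Hm0
       (Rlt_le _ _ (gpos (S p))) O) as [O' [A' V']]; auto.
    assert (ER : Defs.Rn r (S p) = INR m * Defs.Rn r p).
    { rewrite Em. unfold Defs.Rn. simpl. ring. }
    rewrite <- ER in *.
    change (fun x => centered_H0 r gamma h p x
              + gamma (S p) * fluctuation h (S p) (x / Defs.Rn r (S p)))
      with (centered_H0 r gamma h (S p)) in *.
    split; [exact O'|]. split; [simpl; lra|].
    rewrite (tech5 (fun k => gamma k ^ 2)).
    set (v := variance (Defs.Rn r p) (centered_H0 r gamma h p)) in *.
    set (v' := variance (Defs.Rn r (S p)) (centered_H0 r gamma h (S p))) in *.
    set (s := sum_f_R0 (fun k => gamma k ^ 2) p) in *.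
    (* The error splits into the one made at the new scale and the one inherited from the previous
       scales. *)
    replace (v' - (s + gamma (S p) ^ 2))
      with ((v' - v - gamma (S p) ^ 2) + (v - s)) by ring.
    eapply Rle_trans; [apply Rabs_triang|].
    rewrite Rmult_plus_distr_l, Rplus_comm.
    apply Rplus_le_compat; [exact V|].
    eapply Rle_trans; [exact V'|].
    (* With [rho <= INR m] and the geometric bound on the absolute mean, the new error is a fixed
       multiple of [gamma (S p) ^ 2], the variance just added. *)
    apply Rle_trans with (2 * gamma (S p) * (K / rho) * (gamma (S p) / (g - 1))).
    + assert (K / INR m <= K / rho).
      { apply Rmult_le_compat_l; [exact HK|]. apply Rinv_le_contravar; lra. }
      assert (0 <= K / INR m)
        by (apply Rmult_le_pos; [exact HK | left; apply Rinv_0_lt_compat; lra]).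
      apply Rmult_le_compat.
      * apply Rmult_le_pos; [pose proof (gpos (S p)); lra | assumption].
      * apply Rmult_le_pos; [|left; now apply Rinv_0_lt_compat].
        apply RInt_ge_0; [lra | |intros; apply Rabs_pos].
        apply ex_RInt_continuous_everywhere. destruct O. prove_continuous.
      * apply Rmult_le_compat_l; [pose proof (gpos (S p)); lra | assumption].
      * eapply Rle_trans; [exact A|]. apply scale_sum_bound; auto. lra.
    + right. field. lra.
Qed.

Lemma smooth_H0 (r : nat -> Z) (gamma : nat -> R) (h : nat -> R -> R) (p : nat) :
  (forall n, smooth (h n)) -> smooth (H0 r gamma h p).
Proof.
  intros Hs. unfold H0.
  assert (S1 : forall n, smooth (fun x => gamma n * h n (x / Defs.Rn r n))).
  { intros n. apply smooth_scal.
    replace (fun x => h n (x / Defs.Rn r n)) with (fun x => h n (/ Defs.Rn r n * x)).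
    - now apply smooth_comp_scal.
    - apply functional_extensionality. intros x. f_equal. unfold Rdiv. ring. }
  induction p as [|p IH]; simpl; [apply S1|].
  apply (smooth_plus (fun x => sum_f_R0 (fun n => gamma n * h n (x / Defs.Rn r n)) p));
    [exact IH | apply S1].
Qed.

Lemma H0_centered (r : nat -> Z) (gamma : nat -> R) (h : nat -> R -> R) (p : nat)
    (x : R) :
  H0 r gamma h p x
  = centered_H0 r gamma h p x + sum_f_R0 (fun n => gamma n * RInt (h n) 0 1) p.
Proof.
  unfold H0, centered_H0, fluctuation. rewrite <- plus_sum.
  apply sum_eq. intros; ring.
Qed.


Theorem theorem3p2
    (r : nat -> Z) (gamma : nat -> R) (h : nat -> R -> R)
    (r_0 : r 0%nat = 1%Z)
    (rho_min_ge2 : Rbar_le (Finite 2) (rho_min r))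
    (rho_max_fin : Rbar_lt (rho_max r) p_infty)
    (gamma_0 : gamma 0%nat = 1)
    (gamma_min_gt1 : Rbar_lt (Finite 1) (gamma_min gamma))
    (gamma_max_fin : Rbar_lt (gamma_max gamma) p_infty)
    (h_smooth : forall n, smooth (h n))
    (h_periodic : forall n x, h n (x + 1) = h n x)
    (h_at0 : forall n, h n 0 = 0)
    (h_variance : forall n,
        RInt (fun x => (h n x - RInt (h n) 0 1) ^ 2) 0 1 = 1)
    (K0_fin : Rbar_lt (K0 h) p_infty)
    (K1_fin : Rbar_lt (K1 h) p_infty)
    (rho_gt_gamma : Rbar_lt (gamma_max gamma) (rho_min r))
    (eps_lt1 : eps r gamma h < 1)
    (p : nat) :
  1 + 4 * (1 - eps r gamma h) * sum_f_R0 (fun k => gamma k ^ 2) p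
    <= entry (D0 r gamma h p) 1 1
    <= 1 + 4 * (1 + eps r gamma h) * sum_f_R0 (fun k => gamma k ^ 2) p.
Proof.
  destruct (Inf_seq_finite (fun n => IZR (r (S n))) 2 rho_min_ge2) as [Erho Brho].
  destruct (Inf_seq_finite (fun n => gamma (S n) / gamma n) 1
              (Rbar_lt_le _ _ gamma_min_gt1)) as [Eg Bg].
  fold (rho_min r) in Erho, Brho. fold (gamma_min gamma) in Eg, Bg.
  assert (Hrho : 2 <= real (rho_min r))
    by (rewrite Erho in rho_min_ge2; exact rho_min_ge2).
  assert (Hg : 1 < real (gamma_min gamma))
    by (rewrite Eg in gamma_min_gt1; exact gamma_min_gt1).
  unfold eps in *.
  set (rho := real (rho_min r)) in *. set (g := real (gamma_min gamma)) in *.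
  set (K := real (K1 h)) in *.
  (* Positivity is what turns the bounds on the ratios into [g * gamma n <= gamma (S n)]. *)
  assert (gpos : forall n, 0 < gamma n).
  { induction n as [|n IH]; [lra|]. specialize (Bg n).
    replace (gamma (S n)) with (gamma (S n) / gamma n * gamma n) by (field; lra).
    apply Rmult_lt_0_compat; lra. }
  assert (Hgr : forall n, g * gamma n <= gamma (S n)).
  { intros n. replace (gamma (S n)) with (gamma (S n) / gamma n * gamma n)
      by (field; pose proof (gpos n); lra).
    apply Rmult_le_compat_r; [left; apply gpos | apply Bg]. }
  assert (Hl : forall n x y,
    Rabs (fluctuation h n x - fluctuation h n y) <= K * Rabs (x - y)).
  { intros n x y. unfold fluctuation.
    replace (h n x - RInt (h n) 0 1 - (h n y - RInt (h n) 0 1))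
      with (h n x - h n y) by ring.
    apply mean_value_bound; [apply h_smooth|]. intros t. now apply K1_bound. }
  destruct (variance_multiscale r gamma h rho g K p) as [[Co Po Io] [_ V]]; auto.
  { intros n. now apply fluctuation_oscillation. }
  { intros n. unfold variance. rewrite Rdiv_1_r. apply h_variance. }
  assert (HP : 0 < Defs.Rn r p) by
    (apply Rn_pos; auto; intros n; specialize (Brho n); simpl in Brho; lra).
  set (S := sum_f_R0 (fun k => gamma k ^ 2) p) in *.
  assert (HS : 0 <= S) by (apply cond_pos_sum; intros; apply pow2_ge_0).
  set (c := sum_f_R0 (fun n => gamma n * RInt (h n) 0 1) p).
  (* The centered sum integrates to zero over the period, so the constant separating it from [H0] is
     the mean of [H0]. *)
  assert (Mean : RInt (H0 r gamma h p) 0 (Defs.Rn r p) / Defs.Rn r p = c).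
  { rewrite (RInt_ext_R _ (fun x => centered_H0 r gamma h p x + c))
      by (intros; apply H0_centered).
    rewrite RInt_plus_R, RInt_const_R, Io by prove_continuous.
    eq_in_R. field. lra. }
  assert (E : entry (D0 r gamma h p) 1 1
              = 1 + 4 * variance (Defs.Rn r p) (centered_H0 r gamma h p)).
  { unfold D0. change (Gamma0 r gamma h p) with (shear (H0 r gamma h p)).
    rewrite effective_diffusivity_shear.
    - rewrite Mean. unfold variance. do 3 f_equal. apply RInt_ext_R.
      intros x. rewrite H0_centered. fold c. f_equal. ring.
    - exact HP.
    - now apply smooth_H0.
    - intros x. now rewrite !H0_centered, Po. }
  assert (HK : 0 <= 2 * K / (rho * (g - 1))).
  { apply Rmult_le_pos.
    - pose proof (K1_bound h 0 0 K1_fin). pose proof (Rabs_pos (Derive (h 0%nat) 0)).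
      fold K in H. lra.
    - left. apply Rinv_0_lt_compat, Rmult_lt_0_compat; lra. }
  (* The quantity [eps] is twice the relative error [e] of the variance, so the bounds follow with
     room to spare from [0 <= e * S]. *)
  replace (4 * K * / (rho * (g - 1))) with (2 * (2 * K / (rho * (g - 1))))
    by (unfold Rdiv; ring).
  set (e := 2 * K / (rho * (g - 1))) in *.
  rewrite E. apply Rabs_le_between in V.
  assert (0 <= e * S) by now apply Rmult_le_pos.
  split; lra.
Qed.
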